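(* Let $m \ge n \ge 1$ be integers and let $K_{m,n}$ be the complete bipartite graph with parts of sizes $m$ and $n$. Then $\mathrm{Pin}(K_{m,n}) = \{[k, m+n] : n+1 \le k \le m+n\}$ and $\mathrm{pin}(K_{m,n}) = m$.
   Context: Graphs are finite and simple, and $[N] = \{1,2,\ldots,N\}$. For integers $a \le b$, $[a,b] = \{a, a+1, \ldots, b\}$. A labeling of a graph $G$ with $N$ vertices is a bijection $\lambda : V(G) \to [N]$. The label $\lambda(u)$ of a vertex $u$ is a pinnacle of $(G,\lambda)$ if $\lambda(u) > \lambda(v)$ for every neighbor $v$ of $u$. The pinnacle set of $(G,\lambda)$ is the set of all pinnacles of $(G,\lambda)$. A subset $S \subseteq [N]$ is a pinnacle set of $G$ if there is a labeling $\lambda$ of $G$ such that $S$ is the pinnacle set of $(G,\lambda)$. $\mathrm{Pin}(G)$ denotes the collection of all pinnacle sets of $G$, and $\mathrm{pin}(G) = |\mathrm{Pin}(G)|$. *)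

(* Defs.v *)
From mathcomp Require Import all_boot.

Set Implicit Arguments.
Unset Strict Implicit.
Unset Printing Implicit Defensive.

Record sgraph := SGraph {
  vertex :> finType;
  adj : rel vertex;
  adj_sym : symmetric adj;
  adj_irrefl : irreflexive adj
}.

(* For a graph on N vertices, labels live in 'I_N.+1, so that the label set
   [N] = {1, ..., N} is literally [interval 1 N]; 0 is never used as a label. *)
Definition label (G : sgraph) : finType := 'I_(#|G|).+1.

(* Elements of [a, b] exceeding N are dropped; nothing is lost when b <= N. *)
Definition interval (N a b : nat) : {set 'I_N.+1} :=
  [set i : 'I_N.+1 | a <= i <= b].

Definition label_set (G : sgraph) : {set label G} := interval #|G| 1 #|G|.

Definition is_labeling (G : sgraph) (lam : {ffun G -> label G}) : bool :=
  injectiveb lam && ([set lam u | u : G] == label_set G).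

Definition pinnacle_at (G : sgraph) (lam : {ffun G -> label G}) (u : G) : bool :=
  [forall v : G, adj u v ==> ((lam v : nat) < (lam u : nat))].

Definition pinnacles (G : sgraph) (lam : {ffun G -> label G}) :
    {set label G} :=
  [set lam u | u : G & pinnacle_at lam u].

Definition is_pinnacle_set (G : sgraph) (S : {set label G}) : bool :=
  [exists lam : {ffun G -> label G}, is_labeling lam && (S == pinnacles lam)].

Definition Pin (G : sgraph) : {set {set label G}} :=
  [set S in powerset (label_set G) | is_pinnacle_set S].

Definition pin (G : sgraph) : nat := #|Pin G|.

Section CompleteBipartite.
Variables m n : nat.

Definition bip_adj : rel ('I_m + 'I_n)%type := fun u v =>
  match u, v with
  | inl _, inr _ | inr _, inl _ => true
  | _, _ => false
  end.

Lemma bip_adj_sym : symmetric bip_adj.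
Proof. by move=> [i|i] [j|j]. Qed.

Lemma bip_adj_irrefl : irreflexive bip_adj.
Proof. by move=> [i|i]. Qed.

Definition complete_bipartite : sgraph := SGraph bip_adj_sym bip_adj_irrefl.

End CompleteBipartite.

(* Main.v *)
Require Import Defs.
From mathcomp Require Import all_boot.
From mathcomp Require Import zify.

(** In a complete bipartite graph a vertex is a pinnacle exactly when its label
    exceeds every label of the opposite part.  Call [A] the part that contains
    the top label [N] and [B] the other one, and let [t] be the largest label
    in [B].  No vertex of [B] is a pinnacle, since it is adjacent to the vertex
    labelled [N]; a vertex of [A] is a pinnacle iff its label exceeds [t].  As
    all labels above [t] sit in [A], the pinnacle set is [[t + 1, N]]
    ([pinnacles_bipartition]).  The labels of [B] are distinct elements of
    [[1, t]], so [t >= #|B| >= n] ([pinnacles_final_segment]).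

    Conversely, each [t] with [n <= t < N] is attained: give the part of size
    [n] the block of labels [[t - n + 1, t]], and the other part the remaining
    labels in increasing order ([block_label]).  Final segments of different
    lengths are different, so counting pinnacle sets amounts to counting the
    [m] possible values of their left end. *)

Set Implicit Arguments.
Unset Strict Implicit.
Unset Printing Implicit Defensive.

Lemma card_interval (N a b : nat) : b <= N -> #|interval N a b| = b.+1 - a.
Proof.
move=> leb; rewrite -sum1_card.
rewrite (eq_bigl (fun i : 'I_N.+1 => (a <= i) && (i < b.+1))); last first.
  by move=> i; rewrite inE ltnS.
rewrite -(big_ord_widen_cond _ (fun i => a <= i) (fun=> 1)) //.
transitivity (\sum_(a <= i < b.+1) 1); first by rewrite big_geq_mkord.
by rewrite sum_nat_const_nat muln1.
Qed.

Lemma final_segment_inj (N a b : nat) : a <= N -> b <= N ->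
  interval N a N = interval N b N -> a = b.
Proof.
move=> leaN lebN /(congr1 (fun S : {set _} => #|S|)).
rewrite !card_interval //; lia.
Qed.

Section Labelings.
Variables (G : sgraph) (lam : {ffun G -> label G}).
Hypothesis lamP : is_labeling lam.

Lemma labeling_inj : injective lam.
Proof. by case/andP: lamP => /injectiveP. Qed.

Lemma labeling_gt0 (u : G) : 0 < (lam u : nat).
Proof.
case/andP: lamP => _ /eqP im.
have: lam u \in label_set G by rewrite -im imset_f.
by rewrite inE => /andP[].
Qed.

Lemma labeling_le (u : G) : (lam u : nat) <= #|G|.
Proof. by rewrite -ltnS. Qed.

Lemma labeling_surj (l : label G) : 0 < (l : nat) -> exists u, lam u = l.
Proof.
move=> l_gt0; case/andP: lamP => _ /eqP im.
have: l \in label_set G by rewrite inE l_gt0 -ltnS ltn_ord.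
by rewrite -im => /imsetP[u _ ->]; exists u.
Qed.

Lemma labeling_top (u : G) : exists w, (lam w : nat) = #|G|.
Proof.
have [|w lamw] := @labeling_surj ord_max; last by exists w; rewrite lamw.
by apply/card_gt0P; exists u.
Qed.

(** Labels are distinct and start at 1, so [B] injects into [[1, t]]. *)
Lemma labeling_card_le (B : {set G}) (t : nat) :
  t <= #|G| -> (forall v, v \in B -> (lam v : nat) <= t) -> #|B| <= t.
Proof.
move=> let_ leB; rewrite -(card_imset (mem B) labeling_inj).
have -> : t = #|interval #|G| 1 t| by rewrite card_interval ?subn1.
apply/subset_leq_card/subsetP => _ /imsetP[v vB ->].
by rewrite inE labeling_gt0 leB.
Qed.

End Labelings.

(** Injectivity and the right range suffice for a labeling: surjectivity
    follows by counting. *)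
Lemma labeling_of_nat (G : sgraph) (f : G -> nat) :
  injective f -> (forall u, 0 < f u <= #|G|) ->
  exists2 lam : {ffun G -> label G},
    is_labeling lam & forall u, (lam u : nat) = f u.
Proof.
move=> f_inj f_range.
pose lam := [ffun u => inord (f u) : label G].
have lamE u : (lam u : nat) = f u.
  by rewrite ffunE inordK // ltnS; case/andP: (f_range u).
have lam_inj : injective lam.
  by move=> u v /(congr1 (@nat_of_ord _)); rewrite !lamE => /f_inj.
exists lam => //; apply/andP; split; first exact/injectiveP.
rewrite eqEcard card_imset // card_interval // subn1 leqnn andbT.
by apply/subsetP => _ /imsetP[u _ ->]; rewrite inE lamE.
Qed.

(** The two parts enter as [A] and its complement, so that the same lemmas
    serve whichever part carries the top label. *)
Section Bipartition.
Variables (G : sgraph) (A : {set G}).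
Hypothesis adjE : forall u v : G, adj u v = (u \in A) (+) (v \in A).
Variable lam : {ffun G -> label G}.
Hypothesis lamP : is_labeling lam.

(** The hypothesis [lam b < #|G|] is what says that the top label lies in [A];
    this is why no vertex outside [A] can be a pinnacle. *)
Lemma pinnacles_bipartition (b : G) :
  b \notin A -> (forall v, v \notin A -> (lam v : nat) <= lam b) ->
  (lam b : nat) < #|G| ->
  pinnacles lam = interval #|G| (lam b).+1 #|G|.
Proof.
move=> bA max_b ltbN; apply/setP => l; rewrite inE.
apply/imsetP/andP => [[u /[!inE] /forallP pin_u ->] | [ltbl _]].
  rewrite labeling_le; split=> //.
  have [uA | uA] := boolP (u \in A).
    by have:= pin_u b; rewrite adjE uA (negbTE bA).
  have [w topw] := labeling_top lamP b.
  have wA : w \in A by apply: contraLR ltbN => /max_b; rewrite topw -leqNgt.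
  have := pin_u w; rewrite adjE (negbTE uA) wA /= topw => ltNu.
  by have := leq_trans ltNu (labeling_le lam u); rewrite ltnn.
have [|u lamu] := labeling_surj lamP (l := l); first exact: leq_ltn_trans ltbl.
exists u => //; rewrite inE; apply/forallP => v; apply/implyP.
have uA : u \in A.
  by apply: contraLR ltbl => /max_b; rewrite lamu -leqNgt.
rewrite adjE uA /= => /max_b levb.
by rewrite lamu (leq_ltn_trans levb).
Qed.

Lemma pinnacles_final_segment (w : G) :
  w \in A -> (lam w : nat) = #|G| -> 0 < #|~: A| ->
  exists2 t, #|~: A| <= t < #|G| & pinnacles lam = interval #|G| t.+1 #|G|.
Proof.
move=> wA topw /card_gt0P[b0]; rewrite inE => b0A.
pose b := [arg max_(v > b0 | v \notin A) (lam v : nat)].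
have [bA max_b] : b \notin A /\ forall v, v \notin A -> (lam v : nat) <= lam b.
  by rewrite /b; case: arg_maxnP.
have ltbN : (lam b : nat) < #|G|.
  rewrite ltn_neqAle labeling_le andbT; apply: contra bA => /eqP eqb.
  suff -> : b = w by [].
  by apply/(labeling_inj lamP)/val_inj; rewrite /= eqb topw.
exists (lam b : nat); last exact: pinnacles_bipartition.
rewrite ltbN andbT; apply: (labeling_card_le lamP) => [|v]; first exact: ltnW.
by rewrite inE; apply: max_b.
Qed.

End Bipartition.

Section CompleteBipartite.
Variables m n : nat.
Let K := complete_bipartite m n.

Lemma card_complete_bipartite : #|K| = m + n.
Proof. by rewrite card_sum !card_ord. Qed.

Definition left_part : {set K} := [set u : 'I_m + 'I_n | is_inl u].

Lemma adj_left_part (u v : K) :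
  adj u v = (u \in left_part) (+) (v \in left_part).
Proof. by case: u v => [i|i] [j|j]; rewrite !inE. Qed.

Lemma card_left_part : #|left_part| = m.
Proof.
suff -> : left_part = [set inl i | i : 'I_m].
  by rewrite card_imset ?card_ord //; apply: inl_inj.
apply/setP => -[i|j]; rewrite inE; apply/esym; first by apply/imsetP; exists i.
by apply/imsetP => -[].
Qed.

Lemma card_right_part : #|~: left_part| = n.
Proof.
by have := cardsC left_part; rewrite card_left_part card_complete_bipartite; lia.
Qed.

(** The right part receives the [n] consecutive labels ending at [t]; the left
    part fills the labels below and above that block. *)
Definition block_label (t : nat) (u : K) : nat :=
  match u with
  | inl i => if i < t - n then i.+1 else (i + n).+1
  | inr j => (t - n + j).+1
  end.

Lemma block_label_inj (t : nat) : injective (block_label t).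
Proof.
move=> [i|i] [j|j] /=; have := ltn_ord i; have := ltn_ord j.
- move=> _ _ eqij; congr inl; apply: val_inj => /=.
  by move: eqij; case: (ltnP i); case: (ltnP j); lia.
- by case: ifP; lia.
- by case: ifP; lia.
- by move=> _ _ eqij; congr inr; apply: val_inj => /=; lia.
Qed.

Lemma block_label_range (t : nat) (u : K) :
  n <= t < m + n -> 0 < block_label t u <= m + n.
Proof. by case: u => i /=; have := ltn_ord i; try case: ifP; lia. Qed.

Lemma final_segment_pinnacle_set (t : nat) :
  0 < n -> n <= t < m + n -> is_pinnacle_set (G := K) (interval #|K| t.+1 #|K|).
Proof.
move=> n_gt0 t_range; have [] := @labeling_of_nat K (block_label t).
- exact: block_label_inj.
- by move=> u; rewrite card_complete_bipartite block_label_range.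
move=> lam lamP lamE; apply/existsP; exists lam; rewrite lamP /=.
have ltn1 : n.-1 < n by rewrite prednK.
(* The last vertex of the block carries [t], the largest label on the right. *)
pose b : K := inr (Ordinal ltn1).
have lamb : (lam b : nat) = t by rewrite lamE /=; lia.
rewrite (pinnacles_bipartition adj_left_part lamP (b := b)) ?lamb ?inE //.
  move=> [i|j]; rewrite inE // lamE /= => _.
  by have := ltn_ord j; lia.
by rewrite card_complete_bipartite; case/andP: t_range.
Qed.

Lemma pinnacle_set_final_segment (S : {set label K}) :
  0 < n <= m -> is_pinnacle_set S ->
  exists2 t, n <= t < m + n & S = interval #|K| t.+1 #|K|.
Proof.
case/andP=> n_gt0 le_nm /existsP[lam /andP[lamP /eqP ->]].
have [w topw] := labeling_top lamP (inr (Ordinal n_gt0)).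
have [wA | wA] := boolP (w \in left_part).
  have := pinnacles_final_segment adj_left_part lamP wA topw.
  rewrite card_right_part => /(_ n_gt0)[t t_range ->].
  by exists t; rewrite // -card_complete_bipartite.
have adj_right_part u v : adj u v = (u \in ~: left_part) (+) (v \in ~: left_part).
  by rewrite adj_left_part !inE addbN addNb negbK.
have wA' : w \in ~: left_part by rewrite inE.
have := pinnacles_final_segment adj_right_part lamP wA' topw.
rewrite setCK card_left_part => /(_ (leq_trans n_gt0 le_nm))[t t_range ->].
exists t => //; rewrite -card_complete_bipartite.
by case/andP: t_range => /(leq_trans le_nm) -> ->.
Qed.

End CompleteBipartite.

Theorem lemma3p2 (m n : nat) (n_gt0 : 1 <= n) (le_nm : n <= m) :
  Pin (complete_bipartite m n) =
    [set interval #|complete_bipartite m n| k (m + n)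
      | k : 'I_(m + n).+1 & n + 1 <= k <= m + n] /\
  pin (complete_bipartite m n) = m.
Proof.
have cardK := card_complete_bipartite m n.
have PinE : Pin (complete_bipartite m n) =
    [set interval #|complete_bipartite m n| k (m + n)
      | k : 'I_(m + n).+1 & n + 1 <= k <= m + n].
  apply/setP => S; rewrite inE powersetE; apply/andP/imsetP.
    case=> _ /pinnacle_set_final_segment; rewrite n_gt0 le_nm.
    case=> // t /andP[lent ltt] ->.
    exists (Ordinal (ltt : t.+1 < (m + n).+1)); last by rewrite /= -cardK.
    by rewrite inE /= addn1 !ltnS lent.
  case=> -[[|t] lttN]; rewrite inE addn1 /= ?ltn0 // ltnS => t_range ->.
  rewrite -[X in interval _ _ X]cardK; split; last first.
    exact: final_segment_pinnacle_set.
  by apply/subsetP => l; rewrite !inE => /andP[/(leq_ltn_trans (leq0n t)) -> ->].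
split=> //; rewrite /pin PinE card_in_imset.
  transitivity #|interval (m + n) (n + 1) (m + n)|; first by [].
  by rewrite card_interval //; lia.
move=> k1 k2 _ _.
rewrite -[X in interval _ k1 X]cardK -[X in interval _ k2 X]cardK => eq_int.
by apply/val_inj/(final_segment_inj _ _ eq_int); rewrite /= cardK -ltnS.
Qed.
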